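(* Let $n\ge 1$ and let $G$ be a graph on $n$ vertices. Then, for all integers $k\geq 0$, \[\beta_k(X(G)) \leq \bigl(\lceil n/(k+1)\rceil-1\bigr)^{r}\cdot \bigl(\lfloor n/(k+1)\rfloor-1\bigr)^{(k+1) - r},\] where $r = n \bmod (k+1)\in\{0,1,\dots,k\}$ is the remainder of $n$ on division by $k+1$.
   Context: Graphs are finite and simple. For a graph $G$, $X(G)$ denotes the flag complex of $G$: the simplicial complex on $V(G)$ whose $m$-simplices are the $(m+1)$-cliques of $G$. $\beta_k(K)$ denotes the dimension of the reduced simplicial homology $\tilde H_k(K;\mathbf{k})$ with coefficients in a fixed but arbitrary field $\mathbf{k}$. The convention $0^0=1$ is used. *)

(* Defs.v *)
From HB Require Import structures.
From mathcomp Require Import all_boot all_order all_algebra.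
Set Implicit Arguments.
Unset Strict Implicit.
Unset Printing Implicit Defensive.
Import Order.TTheory GRing.Theory Num.Theory.
Local Open Scope ring_scope.

(* The empty face is always present; it is the simplex of dimension -1 that
   makes the simplicial homology below the reduced one. *)
Record simplicial_complex (V : finType) := SimplicialComplex {
  faces :> {set {set V}};
  faces0 : set0 \in faces;
  faces_sub : forall s t : {set V}, s \in faces -> t \subset s -> t \in faces
}.

Definition clique (V : finType) (e : rel V) (s : {set V}) : bool :=
  [forall x in s, forall y in s, (x != y) ==> e x y].

Section FlagComplex.
Variables (V : finType) (e : rel V).

Lemma clique0 : set0 \in [set s | clique e s].
Proof. by rewrite inE; apply/forall_inP => x; rewrite inE. Qed.

Lemma clique_sub (s t : {set V}) :
  s \in [set s | clique e s] -> t \subset s -> t \in [set s | clique e s].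
Proof.
rewrite !inE => /forall_inP Hs /subsetP ts.
apply/forall_inP => x /ts xs; apply/forall_inP => y /ts ys.
exact: (forall_inP (Hs x xs)).
Qed.

Definition flag_complex : simplicial_complex V :=
  SimplicialComplex clique0 clique_sub.

End FlagComplex.

Section Homology.
Variables (F : fieldType) (V : finType).

(* One ambient space for all chains: formal F-linear combinations of subsets of
   V. The chains of each degree of each complex are subspaces of it, and the
   boundary operator is the restriction of a single endomorphism. *)
Definition chain := {ffun {set V} -> F^o}.

Definition simplex (s : {set V}) : chain := [ffun t => (t == s)%:R].

(* The vertices are totally ordered by [enum_rank]; [face_pos s v] is the
   position of v among the vertices of s listed in increasing order. *)
Definition face_pos (s : {set V}) (v : V) : nat :=
  #|[set w in s | (enum_rank w < enum_rank v)%N]|.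

Definition simplex_boundary (s : {set V}) : chain :=
  \sum_(v in s) (-1) ^+ face_pos s v *: simplex (s :\ v).

Definition boundary_fun (c : chain) : chain :=
  \sum_s c s *: simplex_boundary s.

Lemma boundary_fun_linear : linear boundary_fun.
Proof.
move=> a c d; rewrite /boundary_fun scaler_sumr -big_split /=.
by apply: eq_bigr => s _; rewrite !ffunE scalerDl scalerA.
Qed.

HB.instance Definition _ :=
  GRing.isLinear.Build F chain chain *:%R boundary_fun boundary_fun_linear.

(* On a vertex, [boundary] is the augmentation: it sends [set v] to set0. *)
Definition boundary : 'End(chain) := linfun boundary_fun.

Lemma boundary_simplex s : boundary (simplex s) = simplex_boundary s.
Proof.
rewrite lfunE /= /boundary_fun (bigD1 s) //= big1 ?addr0 => [|t /negPf ts].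
  by rewrite ffunE eqxx scale1r.
by rewrite ffunE ts scale0r.
Qed.

Lemma chain_sum_simplex (c : chain) : c = \sum_s c s *: simplex s.
Proof.
apply/ffunP => t; rewrite sum_ffunE (bigD1 t) //= big1 => [|u ut].
  by rewrite !ffunE eqxx addr0 [LHS](esym (mulr1 _)).
by rewrite !ffunE eq_sym (negPf ut) scaler0.
Qed.

Lemma face_posD1_lt (s : {set V}) (v w : V) :
  (enum_rank w < enum_rank v)%N -> face_pos (s :\ v) w = face_pos s w.
Proof.
move=> wv; congr #|pred_of_set _|; apply/setP => x; rewrite !inE.
by case: (x =P v) => // ->; rewrite [RHS]andbC ltnNge (ltnW wv).
Qed.

Lemma face_posD1_gt (s : {set V}) (v w : V) : w \in s ->
  (enum_rank w < enum_rank v)%N -> face_pos s v = (face_pos (s :\ w) v).+1.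
Proof.
move=> ws wv; rewrite /face_pos (cardsD1 w) inE ws wv add1n; congr _.+1.
by congr #|pred_of_set _|; apply/setP => x; rewrite !inE andbA.
Qed.

Lemma boundary_boundary (c : chain) : boundary (boundary c) = 0.
Proof.
rewrite (chain_sum_simplex c) !linear_sum big1 // => s _; rewrite !linearZ /=.
rewrite boundary_simplex linear_sum /=.
under eq_bigr do rewrite linearZ /= boundary_simplex scaler_sumr.
pose f v w : chain := (-1) ^+ face_pos s v *:
  ((-1) ^+ face_pos (s :\ v) w *: simplex (s :\ v :\ w)).
pose lt (v w : V) := (enum_rank v < enum_rank w)%N.
have fN v w : v \in s -> w \in s -> lt v w -> f v w + f w v = 0.
  move=> vs ws vw; rewrite /f (face_posD1_gt vs vw) (face_posD1_lt _ vw).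
  rewrite !scalerA exprS mulN1r mulNr scaleNr [in X in _ - X]mulrC.
  by rewrite !setDDl [[set w] :|: _]setUC subrr.
rewrite (eq_bigr (fun v => \sum_(w in s | lt v w) f v w +
                           \sum_(w in s | lt w v) f v w)); last first.
  move=> v vs; rewrite (bigID (lt v)) /=; congr (_ + _); apply: eq_bigl => w;
    rewrite !inE /lt; case: (w =P v) => [->|/eqP wv] /=;
    rewrite ?ltnn ?andbF //.
  congr (_ && _); rewrite -leqNgt leq_eqVlt orb_idl // => /eqP/val_inj.
  by move/enum_rank_inj => /eqP; rewrite (negPf wv).
rewrite big_split /= [X in _ + X](exchange_big_dep (mem s)) //=; last first.
  by move=> v w _ /andP[].
rewrite -big_split big1 ?scaler0 //= => v vs.
rewrite [X in _ + X](eq_bigl (fun w => (w \in s) && lt v w)); last first.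
  by move=> w; rewrite vs.
by rewrite -big_split big1 //= => w /andP[ws /fN ->].
Qed.

Variable K : simplicial_complex V.

Definition chains (m : nat) : {vspace chain} :=
  <<[seq simplex s | s : {set V} <- enum (faces K) & #|s| == m.+1]>>%VS.

Definition cycles (m : nat) : {vspace chain} := (chains m :&: lker boundary)%VS.

Definition boundaries (m : nat) : {vspace chain} :=
  (boundary @: chains m.+1)%VS.

(* The quotient of cycles by boundaries, realized as a complement of the
   boundaries in the cycles; see [reduced_homologyP]. *)
Definition reduced_homology (m : nat) : {vspace chain} :=
  (cycles m :\: boundaries m)%VS.

Definition betti (m : nat) : nat := \dim (reduced_homology m).

Lemma boundary_chains m c : c \in chains m.+1 -> boundary c \in chains m.
Proof.
move=> cm; suff: (boundary @: chains m.+1 <= chains m)%VS.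
  by move/subvP; apply; exact: memv_img.
rewrite limg_span; apply/span_subvP => _ /mapP[_ /mapP[s + ->] ->].
rewrite mem_filter mem_enum => /andP[/eqP sm sK].
rewrite boundary_simplex; apply: memv_suml => v vs; apply/memvZ/memv_span.
apply: map_f; rewrite mem_filter mem_enum (faces_sub sK (subD1set s v)) andbT.
by rewrite -eqSS -sm (cardsD1 v s) vs.
Qed.

Lemma boundaries_cycles m : (boundaries m <= cycles m)%VS.
Proof.
apply/subvP => _ /memv_imgP[c cm ->].
by rewrite memv_cap boundary_chains //= memv_ker boundary_boundary.
Qed.

(* The projection of cycles onto [reduced_homology] is onto, with kernel the
   boundaries. *)
Lemma reduced_homologyP m (p := addv_pi1 (cycles m) (boundaries m)) :
  (p @: cycles m)%VS = reduced_homology m /\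
  (cycles m :&: lker p)%VS = boundaries m.
Proof.
have BZ := boundaries_cycles m.
have pB c : c \in cycles m -> (p c == 0) = (c \in boundaries m).
  move=> cZ; apply/eqP/idP => [pc0|cB].
    have := addv_pi1_pi2 (subvP (addvSl _ (boundaries m)) _ cZ).
    by rewrite -/p pc0 add0r => <-; exact: memv_pi2.
  have HB0 : (reduced_homology m :&: boundaries m)%VS = 0%VS by exact: capv_diff.
  have cHB : c \in (cycles m :\: boundaries m + boundaries m)%VS.
    exact: subvP (addvSr _ _) _ cB.
  have := daddv_pi_add HB0 cHB.
  have BH0 : (boundaries m :&: reduced_homology m)%VS = 0%VS by rewrite capvC.
  rewrite (daddv_pi_id BH0 cB) => /eqP; rewrite -subr_eq0 addrK => /eqP.
  exact.
split; apply/eqP; rewrite eqEsubv; apply/andP; split; apply/subvP => c.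
- by case/memv_imgP => d _ ->; exact: memv_pi.
- move=> cH; apply/memv_imgP; exists c; first exact: subvP (diffvSl _ _) _ cH.
  by rewrite /p /addv_pi1 daddv_pi_id // capv_diff.
- by rewrite memv_cap memv_ker => /andP[/pB ->].
- by move=> cB; rewrite memv_cap memv_ker pB (subvP BZ).
Qed.

Lemma betti_dimB m : betti m = (\dim (cycles m) - \dim (boundaries m))%N.
Proof.
by rewrite /betti /reduced_homology -(dimv_cap_compl (cycles m) (boundaries m))
  (capv_idPr (boundaries_cycles m)) addKn.
Qed.

End Homology.

(* Main.v *)
Require Import Defs.
From HB Require Import structures.
From mathcomp Require Import all_boot all_order all_algebra.
From mathcomp Require Import ring zify.
Set Implicit Arguments.
Unset Strict Implicit.
Unset Printing Implicit Defensive.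
Import Order.TTheory GRing.Theory Num.Theory.
Local Open Scope ring_scope.

(** Write beta_j(W) for the dimension of the reduced homology of the flag
    complex of G[W], in the degree whose simplices have j vertices (so that
    beta_(k+1)(V) is the Betti number beta_k(X(G))).

    Deleting one vertex v from a complex K gives the Mayer-Vietoris bound
      beta_(j+1)(K) <= beta_(j+1)(K - v) + beta_j(lk v)
    ([betti_card_deletion_link]); for K the flag complex of G[W], K - v and
    lk v are the flag complexes of G[W - v] and of G[W /\ N(v)].  Now let v
    have maximal degree D in G[W] and delete one by one the m - 1 vertices
    other than v that are not adjacent to v, where m = |W| - D.  What remains
    is a cone with apex v, which has no homology ([betti_card_cone]), and each
    link met on the way lives on at most D vertices.  Hence
      beta_(j+1)(W) <= (m - 1) * (a bound for beta_j on |W| - m vertices),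
    and by induction beta_d(W) is at most the largest product of factors
    m_i - 1 over d positive integers m_i of sum at most |W|, and 0 if there are
    no such integers.

    The maximum of such products, attained at balanced m_i, is never computed:
    if y * x ^ m >= m - 1 for every m >= 1, with x >= 1, then the induction
    gives beta_d(W) <= y ^ d * x ^ |W| directly ([betti_card_cliques_le]).
    The sequence m - 1 is log-concave, so for every q >= 1 there is such an
    exponential y * x ^ m that touches it both at m = q + 1 and at m = q + 2,
    namely the one with ratio x = (q + 1) / q ([ratio_tangent]).  For
    q = n %/ d - 1 and d = k + 1 the bound y ^ d * x ^ n is exactly
    q ^ (d - r) * (q + 1) ^ r, as n = (q + 1) d + r.

    When n < 2 d this choice would have q <= 0; then the exponential with
    q = 1 shows that beta_d <= 2 ^ n / 4 ^ d < 1, so the homology vanishes. *)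

(** * Homology graded by the number of vertices *)

Section GradedHomology.
Variables (F : fieldType) (V : finType).
Implicit Types (K : {set {set V}}) (j : nat) (v : V) (s t : {set V}).
Local Notation chain := (chain F V).
Local Notation simplex := (simplex F).
Local Notation boundary := (boundary F V).

(** The grading counts vertices, so that the degree-0 part, spanned by the
    empty face, is available: it carries the homology of empty links. *)
Definition chains_card K j : {vspace chain} :=
  <<[seq simplex s | s : {set V} <- enum K & #|s| == j]>>%VS.

Definition cycles_card K j : {vspace chain} :=
  (chains_card K j :&: lker boundary)%VS.

Definition boundaries_card K j : {vspace chain} :=
  (boundary @: chains_card K j.+1)%VS.

Definition betti_card K j : nat :=
  (\dim (cycles_card K j) - \dim (boundaries_card K j))%N.

Lemma betti_betti_card (K : simplicial_complex V) m :
  betti F K m = betti_card (faces K) m.+1.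
Proof. exact: betti_dimB. Qed.

Lemma chains_cardP K j (c : chain) :
  reflect (forall s, c s != 0 -> (s \in K) /\ #|s| = j) (c \in chains_card K j).
Proof.
apply: (iffP idP) => [cK s | cK].
  have: [forall s, (c s != 0) ==> (s \in K) && (#|s| == j)].
    have -> := @coord_span _ _ _
      (in_tuple [seq simplex s | s : {set V} <- enum K & #|s| == j]) c cK.
    apply/forallP => t; apply/implyP.
    rewrite sum_ffunE; apply: contraNT => Kt; rewrite big1 // => i _.
    rewrite ffunE.
    have : (in_tuple [seq simplex s | s <- enum K & #|s| == j])`_i
       \in [seq simplex s | s <- enum K & #|s| == j].
      by apply: mem_nth; case: i.
    case/mapP => u; rewrite mem_filter mem_enum => /andP[uj uK] ->.
    rewrite ffunE; have [E | _] := eqVneq t u; first by rewrite E uK uj in Kt.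
    by rewrite scaler0.
  by move/forallP/(_ s)/implyP => + /[dup] => /[apply] /andP[-> /eqP].
rewrite (chain_sum_simplex c); apply: memv_suml => s _.
have [-> | /cK[sK sj]] := eqVneq (c s) 0; first by rewrite scale0r mem0v.
apply/memvZ/memv_span/map_f; rewrite mem_filter mem_enum sK sj eqxx //.
Qed.

(** * Deleting a vertex *)

Section Vertex.
Variable v : V.

Definition vsign s : F := (-1) ^+ face_pos s v.

Lemma vsignK s : vsign s * vsign s = 1.
Proof. by rewrite /vsign -expr2 sqrr_sign. Qed.

(** In terms of simplices, [cone] sends s to v * s, and to 0 if v is in s,
    while [contract] sends v * t to t, and to 0 a simplex that avoids v; the
    signs are those that make v the first vertex.  The coordinatewise formulas
    make the supports of the images apparent. *)
Definition cone_fun (c : chain) : chain :=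
  [ffun s : {set V} => if v \in s then vsign s * c (s :\ v) else 0].

Definition contract_fun (c : chain) : chain :=
  [ffun s : {set V} => if v \in s then 0 else vsign (v |: s) * c (v |: s)].

Fact cone_fun_linear : linear cone_fun.
Proof.
move=> a c d; apply/ffunP => s; rewrite !ffunE.
case: ifP => _; last by rewrite scaler0 addr0.
by rewrite mulrDr; congr (_ + _); exact: mulrCA.
Qed.

Fact contract_fun_linear : linear contract_fun.
Proof.
move=> a c d; apply/ffunP => s; rewrite !ffunE.
case: ifP => _; first by rewrite scaler0 addr0.
by rewrite mulrDr; congr (_ + _); exact: mulrCA.
Qed.

HB.instance Definition _ :=
  GRing.isLinear.Build F chain chain *:%R cone_fun cone_fun_linear.
HB.instance Definition _ :=
  GRing.isLinear.Build F chain chain *:%R contract_fun contract_fun_linear.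

Definition cone : 'End(chain) := linfun cone_fun.
Definition contract : 'End(chain) := linfun contract_fun.

Lemma coneE c s : cone c s = if v \in s then vsign s * c (s :\ v) else 0.
Proof. by rewrite lfunE /= ffunE. Qed.

Lemma contractE c s :
  contract c s = if v \in s then 0 else vsign (v |: s) * c (v |: s).
Proof. by rewrite lfunE /= ffunE. Qed.

(** The splitting of a chain into its part through v and its part
    avoiding v. *)
Lemma cone_contractD c : cone (contract c) + contract (cone c) = c.
Proof.
apply/ffunP => s; rewrite !ffunE coneE [contract (cone c) s]contractE.
have [vs | vNs] := boolP (v \in s).
  by rewrite contractE setD11 setD1K // mulrA vsignK mul1r addr0.
by rewrite coneE setU11 setU1K // mulrA vsignK mul1r add0r.
Qed.

Lemma contract_contract c : contract (contract c) = 0.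
Proof.
apply/ffunP => s; rewrite !contractE setU11 ffunE mulr0.
by case: ifP.
Qed.

Lemma contract_eq0P c : contract c = 0 <-> forall s, v \in s -> c s = 0.
Proof.
split=> [c0 s vs | c0].
  have /ffunP/(_ (s :\ v)) := c0; rewrite contractE setD11 setD1K // ffunE.
  by move/eqP; rewrite mulf_eq0 signr_eq0 => /eqP.
by apply/ffunP => s; rewrite contractE ffunE c0 ?setU11 // mulr0; case: ifP.
Qed.

Lemma cone_simplex s :
  cone (simplex s) = if v \in s then 0 else vsign (v |: s) *: simplex (v |: s).
Proof.
apply/ffunP => t; rewrite coneE ffunE; have [vs | vNs] := boolP (v \in s).
  rewrite [RHS]ffunE; case: ifP => // vt; case: eqP => [E | _].
    by move: vs; rewrite -E setD11.
  by rewrite mulr0.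
rewrite !ffunE; have [vt | vNt] := boolP (v \in t).
  have -> : (t :\ v == s) = (t == v |: s).
    by apply/eqP/eqP => [<- | ->]; rewrite ?setD1K ?setU1K.
  by case: eqP => [-> | _]; rewrite ?mulr0 ?scaler0.
case: eqP => [E | _]; last by rewrite scaler0.
by move: vNt; rewrite E setU11.
Qed.

(** A face of a simplex that avoids v avoids v. *)
Lemma boundary_avoid c : contract c = 0 -> contract (boundary c) = 0.
Proof.
move=> /contract_eq0P c0; rewrite {1}(chain_sum_simplex c) !linear_sum /=.
apply: big1 => s _; have [vs | vNs] := boolP (v \in s).
  by rewrite c0 // scale0r !linear0.
rewrite !linearZ /= boundary_simplex linear_sum big1 ?scaler0 //= => w ws.
rewrite linearZ /=; set c' := contract _; suff ->: c' = 0 by rewrite scaler0.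
apply/contract_eq0P => t vt; rewrite ffunE; case: eqP => // E.
by move: vt vNs; rewrite E inE => /andP[_ ->].
Qed.

(** Moving v to the front of v * s shifts the position of w by one; this is
    where the minus sign of d(v * s) = s - v * ds comes from. *)
Lemma vsign_boundary s w : v \notin s -> w \in s ->
  vsign (v |: s) * (-1) ^+ face_pos (v |: s) w =
  - ((-1) ^+ face_pos s w * vsign (v |: (s :\ w))).
Proof.
move=> vNs ws; have wv : w != v by apply: contraNneq vNs => <-.
have sK : (v |: s) :\ v = s by rewrite setU1K.
have sD : (v |: s) :\ w = v |: (s :\ w).
  apply/setP => x; rewrite !inE.
  by have [-> | ] := eqVneq x v; rewrite // eq_sym wv.
rewrite /vsign -sD.
have [vw | wv' | /val_inj/enum_rank_inj E] :=
  ltngtP (enum_rank v) (enum_rank w); last by rewrite E eqxx in wv.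
  rewrite face_posD1_lt // [face_pos _ w](face_posD1_gt _ vw) ?setU11 //.
  by rewrite sK exprS; ring.
rewrite [in LHS](@face_posD1_gt _ _ v w) ?in_setU1 ?ws ?orbT //.
have -> : face_pos s w = face_pos (v |: s) w by rewrite -{1}sK face_posD1_lt.
by rewrite exprS; ring.
Qed.

(** Coning is a homotopy from the identity to 0 on the full simplex: for s
    avoiding v this is d(v * s) = s - v * ds, and for s containing v only the
    face opposite to v survives in the cone of ds. *)
Lemma boundary_cone c : boundary (cone c) + cone (boundary c) = c.
Proof.
rewrite {1 2 3}(chain_sum_simplex c) !linear_sum /= -big_split /=.
apply: eq_bigr => s _; rewrite !linearZ /= -scalerDr; congr (_ *: _).
rewrite cone_simplex boundary_simplex linear_sum /=.
under [X in _ + X]eq_bigr => w ws do rewrite linearZ /= cone_simplex.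
have [vs | vNs] := boolP (v \in s).
  rewrite linear0 add0r (bigD1 v) //= setD11 setD1K // scalerA vsignK scale1r.
  rewrite big1 ?addr0 // => w /andP[ws wv].
  by rewrite in_setD1 eq_sym wv vs scaler0.
rewrite linearZ /= boundary_simplex /simplex_boundary big_setU1 //=.
rewrite setU1K // scalerDr scalerA.
rewrite vsignK scale1r -addrA scaler_sumr -big_split big1 ?addr0 //= => w ws.
rewrite in_setD1 (negPf vNs) andbF !scalerA vsign_boundary //.
suff ->: (v |: s) :\ w = v |: (s :\ w) by rewrite scaleNr addNr.
apply/setP => x; rewrite !inE; have [-> | //] := eqVneq x v.
by rewrite andbT orTb; apply: contraNneq vNs => ->.
Qed.

(** Write c = a + v * b with a and b avoiding v.  Then dc = da + b - v * db,
    whose part through v is - v * db. *)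
Lemma contract_boundary c : contract (boundary c) = - boundary (contract c).
Proof.
set b := contract c; have b0 : contract b = 0 by exact: contract_contract.
have db0 := boundary_avoid b0.
have cK := cone_contractD (boundary b).
rewrite db0 linear0 add0r in cK.
rewrite -{1}(cone_contractD c) -/b !linearD /=.
rewrite (@boundary_avoid (contract (cone c))) ?contract_contract // addr0.
have /(canRL (addrK _)) -> := boundary_cone b.
by rewrite linearB /= b0 cK sub0r.
Qed.

Definition deletion K := [set s : {set V} in K | v \notin s].
Definition link K := [set s : {set V} | (v \notin s) && (v |: s \in K)].

(** The exact sequence 0 -> C(K - v) -> C(K) -> C(lk v)[-1] -> 0, reduced to
    a count of dimensions.  By rank-nullity for [contract], the cycles of K
    have dimension at most that of the cycles of K - v plus that of the cycles
    of the link, while its boundaries have dimension at least the sum of those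
    of the boundaries. *)
Lemma betti_card_deletion_link K j :
  (betti_card K j.+1 <= betti_card (deletion K) j.+1 + betti_card (link K) j)%N.
Proof.
rewrite /betti_card.
have Zcap : (cycles_card K j.+1 :&: lker contract
             <= cycles_card (deletion K) j.+1)%VS.
  apply/subvP => c; rewrite !memv_cap => /andP[/andP[/chains_cardP cK ->]].
  rewrite andbT memv_ker => /eqP/contract_eq0P c0; apply/chains_cardP => s cs.
  have [sK ->] := cK s cs; split=> //; rewrite inE sK.
  by apply: contraNN cs => /c0 ->.
have Zimg : (contract @: cycles_card K j.+1 <= cycles_card (link K) j)%VS.
  apply/subvP => _ /memv_imgP[c + ->]; rewrite !memv_cap !memv_ker.
  move=> /andP[/chains_cardP cK /eqP dc]; apply/andP; split; last first.
    by rewrite -oppr_eq0 -contract_boundary dc linear0.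
  apply/chains_cardP => s; rewrite contractE.
  have [vs | vNs] := boolP (v \in s); first by rewrite eqxx.
  rewrite mulf_eq0 signr_eq0 /= => /cK[sK]; rewrite cardsU1 vNs add1n => -[->].
  by rewrite inE vNs sK.
have Bcap : (boundaries_card (deletion K) j.+1
             <= boundaries_card K j.+1 :&: lker contract)%VS.
  apply/subvP => _ /memv_imgP[c /chains_cardP cK ->].
  rewrite memv_cap memv_ker; apply/andP; split.
    apply: memv_img; apply/chains_cardP => s /cK[].
    by rewrite inE => /andP[].
  apply/eqP/boundary_avoid/contract_eq0P => s vs; apply/eqP.
  by apply: contraTT vs => /cK[]; rewrite inE => /andP[].
have Bimg : (boundaries_card (link K) j
             <= contract @: boundaries_card K j.+1)%VS.
  apply/subvP => _ /memv_imgP[c /chains_cardP cK ->].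
  have c0 : contract c = 0.
    apply/contract_eq0P => s vs; apply/eqP.
    by apply: contraTT vs => /cK[]; rewrite inE => /andP[].
  have pc : contract (cone c) = c.
    by have := cone_contractD c; rewrite c0 linear0 add0r.
  rewrite -[boundary c]opprK -{1}pc -contract_boundary -linearN /=.
  rewrite memv_img // rpredN memv_img //; apply/chains_cardP => s.
  rewrite coneE; case: ifP => [vs | _]; last by rewrite eqxx.
  rewrite mulf_eq0 signr_eq0 /= => /cK[]; rewrite inE setD1K // => /andP[_ sK].
  by rewrite (cardsD1 v s) vs => ->.
have subDD (a b c d : nat) : (a + c - (b + d) <= (a - b) + (c - d))%N by lia.
rewrite -(limg_ker_dim contract (cycles_card K j.+1)).
rewrite -(limg_ker_dim contract (boundaries_card K j.+1)).
apply: leq_trans (subDD _ _ _ _) _.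
exact: leq_add (leq_sub (dimvS Zcap) (dimvS Bcap))
               (leq_sub (dimvS Zimg) (dimvS Bimg)).
Qed.

(** By [boundary_cone], a cycle is the boundary of its cone, and the cone
    stays in K when v is an apex. *)
Lemma betti_card_cone K j :
  (forall s, s \in K -> v |: s \in K) -> betti_card K j = 0%N.
Proof.
move=> Kv; apply/eqP; rewrite subn_eq0; apply/dimvS/subvP => c.
rewrite memv_cap memv_ker => /andP[/chains_cardP cK /eqP dc].
rewrite -(boundary_cone c) dc linear0 addr0 memv_img //.
apply/chains_cardP => s; rewrite coneE; case: ifP => [vs | _]; last first.
  by rewrite eqxx.
rewrite mulf_eq0 signr_eq0 /= => /cK[/Kv]; rewrite setD1K // => -> sj.
by rewrite (cardsD1 v s) vs sj.
Qed.

End Vertex.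

Lemma betti_card0_le1 K : (betti_card K 0 <= 1)%N.
Proof.
apply: leq_trans (leq_subr _ _) _; apply: leq_trans (dimvS (capvSl _ _)) _.
apply: (@leq_trans (\dim <[simplex set0]>%VS)); last first.
  by rewrite dim_vline leq_b1.
apply/dimvS/span_subvP => _ /mapP[s + ->].
by rewrite mem_filter => /andP[/eqP/cards0_eq -> _]; exact: memv_line.
Qed.

Lemma betti_card_eq0 K j :
  (forall s, s \in K -> #|s| != j) -> betti_card K j = 0%N.
Proof.
move=> Kj; apply/eqP; rewrite subn_eq0; apply/dimvS/subvP => c.
rewrite memv_cap => /andP[/chains_cardP cK _].
suff ->: c = 0 by rewrite mem0v.
apply/ffunP => s; rewrite ffunE; apply/eqP; apply: contraT => /cK[/Kj].
by move=> /[swap] ->; rewrite eqxx.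
Qed.

End GradedHomology.

(** * The recursive bound for flag complexes *)

Section FlagBound.
Variables (F : fieldType) (V : finType) (e : rel V).
Hypotheses (e_sym : symmetric e) (e_irr : irreflexive e).
Implicit Types (W M : {set V}) (v : V).

Definition cliques W : {set {set V}} := [set s | clique e s & s \subset W].
Definition nbrs v : {set V} := [set u | e v u].

Lemma cliqueP (s : {set V}) :
  reflect {in s &, forall x y, x != y -> e x y} (clique e s).
Proof.
apply: (iffP forall_inP) => [es x y xs ys | es x xs].
  exact/implyP/(forall_inP (es x xs)).
by apply/forall_inP => y ys; apply/implyP; exact: es.
Qed.

Lemma clique_setU1 v (s : {set V}) : v \notin s ->
  clique e (v |: s) = clique e s && (s \subset nbrs v).
Proof.
move=> vNs; apply/cliqueP/andP => [es | [/cliqueP es /subsetP sv] x y].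
  split.
    by apply/cliqueP => x y xs ys; apply: es; rewrite inE ?xs ?ys orbT.
  apply/subsetP => x xs; rewrite inE es ?setU11 // ?inE ?xs ?orbT //.
  by apply: contraNneq vNs => ->.
case/setU1P=> [-> | xs] /setU1P[-> | ys]; rewrite ?eqxx //.
- by move=> _; have := sv y ys; rewrite inE.
- by move=> _; have := sv x xs; rewrite inE e_sym.
- exact: es.
Qed.

Lemma deletion_cliques v W : deletion v (cliques W) = cliques (W :\ v).
Proof. by apply/setP => s; rewrite !inE subsetD1 andbA. Qed.

(** This is where flagness enters: a set of neighbours of v is a face of the
    link as soon as it is a clique, so the link is again the flag
    complex of an induced subgraph. *)
Lemma link_cliques v W : v \in W -> link v (cliques W) = cliques (W :&: nbrs v).
Proof.
move=> vW; apply/setP => s; rewrite !inE subsetI subUset sub1set vW /=.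
have [vs | vNs] /= := boolP (v \in s).
  apply/esym/negP => /and3P[_ _ /subsetP/(_ v vs)].
  by rewrite inE e_irr.
by rewrite clique_setU1 // -andbA [(_ \subset nbrs v) && _]andbC.
Qed.

Local Notation b W j := (betti_card F (cliques W) j).

(** All the links that occur are of the form W' /\ N(u), where W' is what is
    left of W when u is removed, which is why the bound is required for every
    subset W'. *)
Lemma betti_card_remove (R : numDomainType) W M j (L : R) : M \subset W ->
  (forall u W', u \in W -> W' \subset W -> (b (W' :&: nbrs u) j)%:R <= L) ->
  (b W j.+1)%:R <= #|M|%:R * L + (b (W :\: M) j.+1)%:R.
Proof.
elim: {M}_.+1 {-2}M W (ltnSn #|M|) => // m IH M W Mm MW bL.
have [-> | [u uM]] := set_0Vmem M; first by rewrite setD0 cards0 mul0r add0r.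
have uW := subsetP MW u uM.
have M1 : #|M| = #|M :\ u|.+1 by rewrite (cardsD1 u) uM.
have : (b (W :\ u) j.+1)%:R <= #|M :\ u|%:R * L + (b (W :\: M) j.+1)%:R.
  have -> : W :\: M = (W :\ u) :\: (M :\ u) by rewrite setDDl setD1K.
  apply: IH; [by rewrite -ltnS -M1 | exact: setSD | move=> w W' wW W'W].
  by apply: bL; [case/setD1P: wW | exact: subset_trans W'W (subD1set _ _)].
have := bL u W uW (subxx W).
have := betti_card_deletion_link F u (cliques W) j.
rewrite deletion_cliques link_cliques // -(ler_nat R) natrD M1 mulrS.
move=> h1 h2 h3; apply: le_trans h1 _.
by rewrite mulrDl mul1r addrC -addrA lerD.
Qed.

(** With v of maximal degree D in G[W] and M the set of its non-neighbours in
    W, v itself excluded, the induction step reads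
    |M| * (y ^ d * x ^ D) <= (y * x ^ (|M| + 1)) * (y ^ d * x ^ D),
    and |W| = |M| + 1 + D: the hypothesis on y and x is used at
    m = |M|. *)
Lemma betti_card_cliques_le (R : numDomainType) (x y : R) W d :
  1 <= x -> 0 <= y -> (forall m, m%:R <= y * x ^+ m.+1) ->
  (b W d)%:R <= y ^+ d * x ^+ #|W|.
Proof.
move=> x1 y0 xy; elim: d W => [|d IH] W.
  rewrite mul1r; apply: (@le_trans _ _ 1); last exact: exprn_ege1.
  by rewrite lern1 betti_card0_le1.
have x0 : 0 <= x by apply: le_trans x1; exact: ler01.
have [-> | [v0 v0W]] := set_0Vmem W.
  rewrite betti_card_eq0 ?mulr_ge0 ?exprn_ge0 // => s; rewrite inE subset0.
  by case/andP => _ /eqP ->; rewrite cards0.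
have [v vW vmax] : exists2 v, v \in W &
    forall u, u \in W -> (#|W :&: nbrs u| <= #|W :&: nbrs v|)%N.
  by case: (arg_maxnP (fun u => #|W :&: nbrs u|) v0W) => v; exists v.
pose M := (W :\ v) :\: nbrs v.
have MW : M \subset W by apply: subset_trans (subsetDl _ _) (subD1set _ _).
have WM : #|W| = (#|M|.+1 + #|W :&: nbrs v|)%N.
  have -> : W :&: nbrs v = (W :\ v) :&: nbrs v.
    apply/setP => u; rewrite !inE.
    by have [-> | //] := eqVneq u v; rewrite e_irr !andbF.
  rewrite (cardsD1 v W) vW -(cardsID (nbrs v) (W :\ v)) addSn.
  by rewrite [(#|M| + _)%N]addnC.
(* What is left is v and its neighbours in W. *)
have cone0 : b (W :\: M) d.+1 = 0%N.
  apply: (@betti_card_cone _ _ v) => s; rewrite !inE => /andP[es sWM].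
  have [vs | vNs] := boolP (v \in s).
    suff ->: v |: s = s by rewrite es sWM.
    by apply/setUidPr; rewrite sub1set.
  rewrite clique_setU1 // es subUset sWM sub1set !inE eqxx vW andbF /= andbT.
  apply/subsetP => u us; have := subsetP sWM u us; rewrite !inE.
  have [E | _] := eqVneq u v; first by rewrite -E us in vNs.
  by case: (e v u); case: (u \in W).
have bL u W' : u \in W -> W' \subset W ->
    (b (W' :&: nbrs u) d)%:R <= y ^+ d * x ^+ #|W :&: nbrs v|.
  move=> uW W'W; apply: le_trans (IH _) _.
  rewrite ler_wpM2l ?exprn_ge0 //; apply: ler_weXn2l => //.
  by apply: leq_trans (vmax u uW); apply/subset_leq_card/setSI.
apply: le_trans (betti_card_remove MW bL) _; rewrite cone0 addr0.
rewrite WM exprD exprS mulrACA.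
by rewrite ler_wpM2r // mulr_ge0 ?exprn_ge0.
Qed.

End FlagBound.

(** * The exponential touching m at q and q + 1 *)

Section Tangent.
Variables (R : realFieldType) (q : nat).
Hypothesis q_gt0 : (0 < q)%N.
Let x : R := q.+1%:R / q%:R.

(** The claim is m * x ^ q <= q * x ^ m, with equality at m = q and at
    m = q + 1.  Away from these values it propagates: m grows by the factor
    (m + 1) / m, which is at most x above q and at least x below q. *)
Lemma ratio_tangent m : m%:R <= q%:R / x ^+ q.+1 * x ^+ m.+1.
Proof.
have q0 : 0 < q%:R :> R by rewrite ltr0n.
have qx : q%:R * x = q.+1%:R by rewrite /x mulrC divfK // gt_eqF.
have x0 : 0 < x by rewrite divr_gt0 ?ltr0n.
have above j : (q + j)%:R <= q%:R * x ^+ j.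
  elim: j => [|j IH]; first by rewrite addn0 mulr1.
  rewrite exprSr mulrA.
  apply: (@le_trans _ _ ((q + j)%:R * x)); last by rewrite ler_wpM2r // ltW.
  rewrite -(ler_pM2l q0) mulrCA qx -!natrM ler_nat; lia.
have below j : forall i, (i + j)%N = q -> i%:R * x ^+ j <= q%:R.
  elim: j => [|j IH] i ijq; first by rewrite -ijq addn0 mulr1.
  apply: le_trans (IH i.+1 _); last by rewrite addSnnS.
  rewrite exprS mulrA ler_wpM2r ?exprn_ge0 ?(ltW x0) //.
  rewrite -(ler_pM2l q0) mulrCA qx -!natrM ler_nat; lia.
rewrite mulrAC ler_pdivlMr ?exprn_gt0 // !exprSr.
rewrite mulrA [leRHS]mulrA (ler_pM2r x0).
have [qm | mq] := leqP q m.
  by rewrite -(subnKC qm) exprD mulrCA [leLHS]mulrC ler_pM2l ?exprn_gt0.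
rewrite -{1}(subnKC (ltnW mq)) exprD [x ^+ m * _]mulrC !mulrA.
by rewrite ler_pM2r ?exprn_gt0 //; apply: below; lia.
Qed.

End Tangent.

(** * The theorem *)

Lemma floor_div_nat (n d : nat) : (0 < d)%N ->
  Num.floor (n%:R / d%:R : rat) = (n %/ d)%:Z.
Proof.
move=> d0; apply: floor_def; rewrite intrD -!pmulrn natr1.
rewrite ler_pdivlMr ?ltr_pdivrMr ?ltr0n // -!natrM ler_nat ltr_nat.
by rewrite leq_divM ltn_ceil.
Qed.

Lemma ceil_div_nat (n d : nat) : (0 < d)%N -> (0 < n %% d)%N ->
  Num.ceil (n%:R / d%:R : rat) = (n %/ d).+1%:Z.
Proof.
move=> d0 r0; apply: ceil_def; rewrite -addn1 PoszD addrK -!pmulrn.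
rewrite ler_pdivrMr ?ltr_pdivlMr ?ltr0n // -!natrM ler_nat ltr_nat addn1.
rewrite (ltnW (ltn_ceil n d0)) andbT.
by rewrite {2}(divn_eq n d) -[X in (X < _)%N]addn0 ltn_add2l.
Qed.

Lemma betti_flag_complex (F : fieldType) (V : finType) (e : rel V) k :
  betti F (flag_complex e) k = betti_card F (cliques e [set: V]) k.+1.
Proof.
rewrite betti_betti_card; congr betti_card; apply/setP => s.
by rewrite !inE subsetT andbT.
Qed.

Theorem theorem10 (F : fieldType) (V : finType) (e : rel V)
    (e_sym : symmetric e) (e_irr : irreflexive e)
    (n : nat) (n_ge1 : (1 <= n)%N) (cardV : #|V| = n) (k : nat) :
  let r := (n %% k.+1)%N in
  (betti F (flag_complex e) k)%:Z <=
    (Num.ceil (n%:R / k.+1%:R : rat) - 1) ^+ r *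
    (Num.floor (n%:R / k.+1%:R : rat) - 1) ^+ (k.+1 - r).
Proof.
cbv zeta; set d := k.+1; set r := (n %% d)%N; have d_gt0 : (0 < d)%N by [].
have r_lt : (r < d)%N by rewrite ltn_mod.
have nE := divn_eq n d; rewrite -/r in nE.
have bound q : (0 < q)%N -> (betti F (flag_complex e) k)%:R <=
    (q%:R / (q.+1%:R / q%:R) ^+ q.+1) ^+ d * (q.+1%:R / q%:R) ^+ n :> rat.
  move=> q0; rewrite betti_flag_complex -cardV -cardsT.
  apply: betti_card_cliques_le => //; last exact: ratio_tangent.
    by rewrite ler_pdivlMr ?ltr0n // mul1r ler_nat.
  by rewrite divr_ge0 ?exprn_ge0 ?divr_ge0 ?ler0n.
rewrite floor_div_nat //.
(* If n < 2 d then both sides vanish: on the right, the first factor is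
   0 ^+ n for n < d, and the second one is 0 ^+ (d - r) otherwise. *)
have [n_lt | n_ge] := ltnP n (2 * d).
  suff -> : betti F (flag_complex e) k = 0%N.
    have [n_d | d_n] := ltnP n d.
      rewrite ceil_div_nat ?modn_small // divn_small // subrr.
      by rewrite /r modn_small // expr0n eqn0Ngt n_ge1 mul0r.
    have -> : (n %/ d)%N = 1%N by nia.
    by rewrite subrr (expr0n _ (d - r)) subn_eq0 leqNgt r_lt mulr0.
  apply/eqP; rewrite -leqn0 -ltnS -(ltr_nat rat).
  apply: le_lt_trans (bound 1%N isT) _.
  rewrite divr1 mul1r exprVn -exprM mulrC ltr_pdivrMr ?exprn_gt0 //.
  by rewrite mul1r ltr_eXn2l.
have [q nq q0] : exists2 q, (n %/ d)%N = q.+1 & (0 < q)%N.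
  by exists (n %/ d).-1; nia.
rewrite nq -[q.+1]addn1 PoszD addrK.
(* For r = 0 the ceiling is q + 1, not q + 2, but its exponent is 0. *)
have -> : (Num.ceil (n%:R / d%:R : rat) - 1) ^+ r = q.+1%:Z ^+ r.
  have [-> // | r0] := posnP r.
  by rewrite ceil_div_nat // nq -[q.+2]addn1 PoszD addrK.
rewrite -(ler_int rat) rmorphM !rmorphXn /= -!pmulrn.
apply: le_trans (bound q q0) _; rewrite le_eqVlt; apply/orP; left; apply/eqP.
have qN0 : q%:R != 0 :> rat by rewrite pnatr_eq0 -lt0n.
have q1N0 : q.+1%:R != 0 :> rat by rewrite pnatr_eq0.
have xN0 : (q.+1%:R / q%:R) ^+ q.+1 != 0 :> rat.
  by rewrite expf_neq0 // mulf_neq0 ?invr_eq0.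
(* Since n = (q + 1) d + r, the bound reduces to q ^ d * x ^ r. *)
rewrite [in LHS]nE nq exprD exprM mulrA -exprMn divfK //.
rewrite -{1}(subnK (ltnW r_lt)) exprD expr_div_n -mulrA [q%:R ^+ r * _]mulrC.
by rewrite divfK ?expf_neq0 // mulrC.
Qed.
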